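(* Let $\mathcal{Q}=(E^0,E^1,r,s,\lambda)$ be a topological quiver, $G$ a locally compact group, and $\kappa:E^1\to G$ a continuous map. Put $F^0=E^0\times G$, $F^1=E^1\times G$, define $r_\kappa,s_\kappa:F^1\to F^0$ by $r_\kappa(e,g)=(r(e),\kappa(e)g)$ and $s_\kappa(e,g)=(s(e),g)$, and define $\lambda_\kappa=\{\lambda_{v,g}\}_{(v,g)\in F^0}$ by $\lambda_{v,g}(U)=\lambda_v(\{e\in E^1 : (e,g)\in U\})$. Then $\mathcal{Q}\times_\kappa G=(F^0,F^1,r_\kappa,s_\kappa,\lambda_\kappa)$ is a topological quiver.
   Context: A topological quiver $\mathcal{Q}=(E^0,E^1,r,s,\lambda)$ consists of locally compact Hausdorff spaces $E^0$ (vertices) and $E^1$ (edges), continuous maps $r,s:E^1\to E^0$ with $s$ open, and a full $s$-system $\lambda=\{\lambda_v\}_{v\in E^0}$, that is, a family of positive Radon measures on $E^1$ with $\operatorname{supp}\lambda_v=s^{-1}(v)$ such that $v\mapsto\int f\,d\lambda_v$ is continuous for every $f\in C_c(E^1)$. By convention all systems of measures are also assumed proper, i.e. $\lambda_v\neq0$ for every $v$ (so $s$ is surjective). *)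

(* Defs.v *)
From HB Require Import structures.
From mathcomp Require Import all_boot all_order all_algebra.
From mathcomp Require Import complex.
From mathcomp Require Import all_classical all_reals all_analysis.

Set Implicit Arguments.
Unset Strict Implicit.
Unset Printing Implicit Defensive.

Import Order.TTheory GRing.Theory Num.Theory.
Import numFieldNormedType.Exports.

Local Open Scope classical_set_scope.
Local Open Scope ring_scope.

HB.mixin Record isTopologicalGroup G of Topological G & Group G := {
  mulg_continuous : continuous (fun z : G * G => (z.1 * z.2)%g) ;
  invg_continuous : continuous (fun x : G => (x^-1)%g)
}.

#[short(type="topologicalGroupType")]
HB.structure Definition TopologicalGroup :=
  {G of Topological G & Group G & isTopologicalGroup G}.

Definition locally_compact_hausdorff (T : topologicalType) : Prop :=
  locally_compact [set: T] /\ hausdorff_space T.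

Definition open_map (S T : topologicalType) (f : S -> T) : Prop :=
  forall U : set S, open U -> open (f @` U).

Definition borel_sets (T : topologicalType) : set (set T) := <<s open >>.

(* [measurableType] is a structure of pointed types, whereas the spaces of a
   quiver may be empty. Measures are therefore set functions on a bare
   topological space, and the library's measure theory is available on
   [borelType x0], the space T pointed at x0 with its Borel sets; its
   measurable sets do not depend on x0. *)
Section borelType.
Context {T : topologicalType}.

Definition borelType (x0 : T) : Type := T.

Variable x0 : T.

HB.instance Definition _ := Topological.on (borelType x0).
HB.instance Definition _ := isPointed.Build (borelType x0) x0.
HB.instance Definition _ :=
  @isMeasurable.Build (sigma_display (@open T)) (borelType x0) (@borel_sets T)
    (@sigma_algebra0 _ setT (@open T))
    (@sigma_algebraC (borelType x0) (@open T))
    (@sigma_algebra_bigcup _ setT (@open T)).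

End borelType.

Section measures.
Context {R : realType} {T : topologicalType}.
Implicit Types mu : set T -> \bar R.
Local Open Scope ereal_scope.

(* Only the values on Borel sets matter; as in the library's measures, the set
   function is also asked to be nonnegative on the other sets. *)
Record borel_measure mu : Prop := {
  borel_measure0 : mu set0 = 0 ;
  borel_measure_ge0 : forall A, 0 <= mu A ;
  borel_measure_sigma_additive : forall F : (set T)^nat,
    (forall n, borel_sets (F n)) -> trivIset setT F ->
    (fun n => \sum_(0 <= i < n) mu (F i)) @ \oo --> mu (\bigcup_n F n)
}.

Lemma borel_measureP (x0 : T) mu :
  borel_measure mu <->
  exists m : {measure set (borelType x0) -> \bar R}, m = mu :> (set T -> \bar R).
Proof.
split=> [[mu0 mu_ge0 mu_add]|[m <-]].
  have mu_add' : semi_sigma_additive (mu : set (borelType x0) -> \bar R).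
    by move=> F mF tF _; exact: mu_add.
  pose M := isMeasure.Build _ (borelType x0) R mu mu0 mu_ge0 mu_add'.
  by exists (HB.pack_for {measure set (borelType x0) -> \bar R} mu M).
split=> [|A|F mF tF]; [exact: measure0|exact: measure_ge0|].
exact: (@measure_sigma_additive _ _ _ m F).
Qed.

Record radon_measure mu : Prop := {
  radon_borel_measure : borel_measure mu ;
  radon_compact_finite : forall K, compact K -> mu K < +oo ;
  radon_outer_regular : forall A, borel_sets A ->
    mu A = ereal_inf [set mu U | U in [set U | open U /\ A `<=` U]] ;
  radon_inner_regular : forall U, open U ->
    mu U = ereal_sup [set mu K | K in [set K | compact K /\ K `<=` U]]
}.

Definition measure_support mu : set T :=
  ~` \bigcup_(U in [set U | open U /\ mu U = 0]) U.

End measures.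

Section complex_functions.
Context {R : realType} {T : topologicalType}.

(* R[i]^o is R[i] with the topology of its modulus. *)
Definition Cc (f : T -> R[i]^o) : Prop :=
  continuous f /\ compact (closure [set x | f x != 0]).

Definition complex_integral (x0 : T) (mu : set T -> \bar R) (f : T -> R[i]^o)
    : R[i]^o :=
  let m : set (borelType x0) -> \bar R := mu in
  Complex (fine (\int[m]_x (complex.Re (f x))%:E))
          (fine (\int[m]_x (complex.Im (f x))%:E)).

End complex_functions.

Record quiver (R : realType) := Quiver {
  vertex : topologicalType ;
  edge : topologicalType ;
  range_map : edge -> vertex ;
  source_map : edge -> vertex ;
  edge_measure : vertex -> set edge -> \bar R
}.

Record topological_quiver (R : realType) (Q : quiver R) : Prop := {
  vertex_lch : locally_compact_hausdorff (vertex Q) ;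
  edge_lch : locally_compact_hausdorff (edge Q) ;
  range_map_continuous : continuous (@range_map R Q) ;
  source_map_continuous : continuous (@source_map R Q) ;
  source_map_open : open_map (@source_map R Q) ;
  edge_measure_radon :
    forall v : vertex Q, radon_measure (edge_measure v) ;
  edge_measure_support : forall v : vertex Q,
    measure_support (edge_measure v) = @source_map R Q @^-1` [set v] ;
  (* The edge x0 only gives access to the integral. Without edges the clause
     says nothing and has nothing to say: edge_measure_proper then forces the
     vertex space to be empty. *)
  edge_measure_continuous :
    forall (x0 : edge Q) (f : edge Q -> R[i]^o), Cc f ->
    continuous (fun v : vertex Q => complex_integral x0 (edge_measure v) f) ;
  edge_measure_proper : forall v : vertex Q,
    exists2 A, borel_sets A & edge_measure v A != 0%E
}.

Definition skew_product (R : realType) (Q : quiver R)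
    (G : topologicalGroupType) (kappa : edge Q -> G) : quiver R :=
  @Quiver R (vertex Q * G)%type (edge Q * G)%type
    (fun eg => (range_map eg.1, (kappa eg.1 * eg.2)%g))
    (fun eg => (source_map eg.1, eg.2))
    (fun vg U => edge_measure vg.1 [set e | U (e, vg.2)]).

(* Main.v *)
Require Import Defs.
From HB Require Import structures.
From mathcomp Require Import all_boot all_order all_algebra.
From mathcomp Require Import complex.
From mathcomp Require Import all_classical all_reals all_analysis.
From mathcomp Require Import measurable_realfun.

Set Implicit Arguments.
Unset Strict Implicit.
Unset Printing Implicit Defensive.

Import Order.TTheory GRing.Theory Num.Theory.
Import numFieldNormedType.Exports.

Local Open Scope classical_set_scope.
Local Open Scope ring_scope.

(* The measure lambda_(v,g) is the image of lambda_v under the closed embedding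
   e |-> (e,g), so it is Radon with support supp(lambda_v) x {g}; outer
   regularity uses that the complement of the slice E x {g} is open. For h in
   Cc(E x G), integrating h against lambda_(v,g) is integrating h(.,g) against
   lambda_v. If K is the projection of supp h to E and chi >= 1 on K is a cutoff
   in Cc(E), then |h(e,g) - h(e,g0)| <= d chi(e) for g near g0, so passing from
   g to g0 costs at most d times the integral of chi, which is locally bounded
   in v; continuity in v at the fixed g0 is the hypothesis on lambda. *)

(** * Products: separation, local compactness, open maps and slices *)

Lemma hausdorff_prod (T U : topologicalType) :
  hausdorff_space T -> hausdorff_space U -> hausdorff_space (T * U)%type.
Proof.
move=> hT hU [p1 p2] [q1 q2] /= pq.
congr (_, _); [apply: hT|apply: hU] => A B pA qB.
- have [||z [[Az _] [Bz _]]] := pq (A `*` setT) (B `*` setT).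
  + by exists (A, setT) => //; split => //; exact: filterT.
  + by exists (B, setT) => //; split => //; exact: filterT.
  + by exists z.1.
- have [||z [[_ Az] [_ Bz]]] := pq (setT `*` A) (setT `*` B).
  + by exists (setT, A) => //; split => //; exact: filterT.
  + by exists (setT, B) => //; split => //; exact: filterT.
  + by exists z.2.
Qed.

Lemma locally_compact_nbhs (T : topologicalType) (x : T) :
  locally_compact [set: T] -> exists V, [/\ nbhs x V, compact V & closed V].
Proof.
move=> lT; have [U xU [cU clU]] := lT x I; exists U; split => //.
by move: xU; rewrite withinET.
Qed.

Lemma locally_compact_hausdorff_prod (T U : topologicalType) :
  locally_compact_hausdorff T -> locally_compact_hausdorff U ->
  locally_compact_hausdorff (T * U)%type.
Proof.
move=> [lT hT] [lU hU]; split; last exact: hausdorff_prod.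
move=> [x y] _.
have [V [xV cV _]] := locally_compact_nbhs x lT.
have [W [yW cW _]] := locally_compact_nbhs y lU.
have cVW : compact (V `*` W) by exact: compact_setX.
exists (V `*` W); first by rewrite withinET; exists (V, W).
by split=> //; exact: compact_closed (hausdorff_prod hT hU) cVW.
Qed.

Lemma continuous_pair (S T U : topologicalType) (f : S -> T) (g : S -> U) :
  continuous f -> continuous g -> continuous (fun x => (f x, g x)).
Proof. by move=> cf cg x; apply: cvg_pair; [exact: cf|exact: cg]. Qed.

Lemma continuous_comp_fst (S T U : topologicalType) (f : S -> T) :
  continuous f -> continuous (fun z : S * U => f z.1).
Proof. by move=> cf z; apply: continuous_comp; [exact: cvg_fst|exact: cf]. Qed.

Lemma open_map_prodr (S T U : topologicalType) (f : S -> T) :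
  open_map f -> open_map (fun z : S * U => (f z.1, z.2)).
Proof.
move=> fo W; rewrite !openE => oW _ [[s u] /oW[[A B] [/= sA uB] AB] <-].
(* The factor [A] is only a neighbourhood of [s]; its interior is open, so its image under [f] is
   open and contains [f s]. *)
exists (f @` A°, B) => /=.
  split=> //; apply: open_nbhs_nbhs; split; last by exists s.
  by apply: fo; exact: open_interior.
by move=> [t u'] [/= [a /interior_subset Aa <-] Bu']; exists (a, u') => //;
  exact: AB.
Qed.

Lemma continuous_pairl (T U : topologicalType) (u : U) :
  continuous (fun t : T => (t, u)).
Proof. by move=> t; apply: cvg_pair; [exact: cvg_id|exact: cvg_cst]. Qed.

Lemma open_section (T U : topologicalType) (u : U) (A : set (T * U)) :
  open A -> open [set t | A (t, u)].
Proof. by move=> oA; apply: open_comp oA => t _; exact: continuous_pairl. Qed.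

Lemma borel_sets_preimage (S T : topologicalType) (f : S -> T) (A : set T) :
  continuous f -> borel_sets A -> borel_sets (f @^-1` A).
Proof.
move=> /continuousP cf;
apply: (smallest_sub (X := [set A | borel_sets (f @^-1` A)])).
  split=> /=.
  - exact: sigma_algebra0.
  - by move=> B Bf; rewrite setTD preimage_setC -setTD; exact: sigma_algebraCD.
  - by move=> F mF; rewrite preimage_bigcup; exact: sigma_algebra_bigcup.
by move=> U oU; apply: sub_sigma_algebra; exact: cf.
Qed.

(** * Radon measures carried by a slice *)

Section section_measure.
Context {R : realType} {E G : topologicalType}.
Variables (mu : set E -> \bar R) (g : G).
Let nu (A : set (E * G)) : \bar R := mu [set e | A (e, g)].

Lemma section_borel_measure : borel_measure mu -> borel_measure nu.
Proof.
move=> [mu0 mu_ge0 mu_add]; split=> [|A|F mF tF]; rewrite /nu//.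
apply: (mu_add (fun n => [set e | F n (e, g)])) => [n|].
  exact: (borel_sets_preimage (@continuous_pairl _ _ g) (mF n)).
by move=> i j _ _ [e [Fi Fj]]; apply: (tF i j) => //; exists (e, g).
Qed.

(** Points of a Hausdorff space are closed, so [K] meets the slice over [g] in a compact set, and
    the section is the projection of that set. *)
Lemma section_compact (K : set (E * G)) :
  hausdorff_space G -> compact K -> compact [set e | K (e, g)].
Proof.
move=> hG cK.
have -> : [set e | K (e, g)] = fst @` (K `&` snd @^-1` [set g]).
  apply/seteqP; split=> [e Ke|_ [[e h] [Keh /= <-] <-]] //.
  by exists (e, g).
apply: continuous_compact.
  by apply: continuous_subspaceT => z; exact: cvg_fst.
apply: compact_closedI => //; apply: closed_comp.
  by move=> z _; exact: cvg_snd.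
exact: accessible_closed_set1 (hausdorff_accessible hG) g.
Qed.

Lemma section_radon_measure :
  hausdorff_space G -> radon_measure mu -> radon_measure nu.
Proof.
move=> hG [bmu fmu omu imu]; split.
- exact: section_borel_measure.
- by move=> K cK; apply: fmu; exact: section_compact.
- move=> A mA; rewrite /nu omu; last first.
    exact: (borel_sets_preimage (@continuous_pairl _ _ g) mA).
  congr ereal_inf; apply/seteqP; split=> _ [U [oU AU] <-]; last first.
    exists [set e | U (e, g)] => //; split; last by move=> e /AU.
    exact: open_section.
  (* Adding everything off the slice makes this open set contain all of [A], while its section at
     [g] is still [U]. *)
  exists ((fst @^-1` U) `|` snd @^-1` (~` [set g])); last first.
    rewrite /nu; congr mu; apply/seteqP; split=> [e []|e Ue] //=.
    by left.
  split; last first.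
    move=> [e h] Aeh; have [hg|] := pselect (h = g); last by right.
    by left; apply: AU; rewrite /= -hg.
  apply: openU; apply: open_comp => //.
  + by move=> z _; exact: cvg_fst.
  + by move=> z _; exact: cvg_snd.
  + apply: closed_openC.
    exact: accessible_closed_set1 (hausdorff_accessible hG) g.
- move=> U oU; rewrite /nu imu; last first.
    exact: open_section.
  congr ereal_sup; apply/seteqP; split=> _ [K [cK KU] <-].
    (* Placing [K] in the slice gives a compact subset of [U] whose section at [g] is [K]. *)
    exists (K `*` [set g]); last first.
      by rewrite /nu; congr mu; apply/seteqP; split=> [e []|e Ke].
    split; first by apply: compact_setX => //; exact: compact_set1.
    by move=> [e h] [/= Ke ->]; exact: KU.
  exists [set e | K (e, g)] => //; split; first exact: section_compact.
  by move=> e /KU.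
Qed.

Lemma section_support : hausdorff_space G -> mu set0 = 0%E ->
  measure_support nu = [set z | measure_support mu z.1 /\ z.2 = g].
Proof.
move=> hG mu0; have oC : open (~` [set g]).
  apply: closed_openC.
  exact: accessible_closed_set1 (hausdorff_accessible hG) g.
apply/seteqP; split=> [[e h] eh|[e h] [/= se ->] [U [oU nuU] Ue]] /=;
  last first.
  apply: se; exists [set e | U (e, g)] => //; split => //.
  exact: open_section.
have hg : h = g.
  (* For [h] other than [g], the complement of the slice is an open set around the point whose
     section at [g] is empty, hence null. *)
  apply: contrapT => hg; apply: eh;
    exists (snd @^-1` (~` [set g])) => //; split.
    by apply: open_comp => // z _; exact: cvg_snd.
  rewrite /nu (_ : [set _ | _] = set0) //.
  by apply/seteqP; split=> // e' /=; exact.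
split=> // -[U [oU muU] Ue]; apply: eh; exists (fst @^-1` U) => //; split => //.
by apply: open_comp => // z _; exact: cvg_fst.
Qed.

End section_measure.

(** * Cutoff functions of compact support *)

Section cutoff.
Context {R : realType} {T : topologicalType}.

Definition nonneg_Cc (f : T -> R) :=
  [/\ continuous f, forall x, 0 <= f x &
      compact (closure [set x | f x != 0])].

Lemma nonneg_Cc0 : nonneg_Cc (fun=> 0).
Proof.
split=> //; first by move=> x; exact: cvg_cst.
rewrite (_ : [set _ | _] = set0) ?closure0; first exact: compact0.
by apply/seteqP; split=> // x /=; rewrite eqxx.
Qed.

Lemma nonneg_CcD f g : nonneg_Cc f -> nonneg_Cc g ->
  nonneg_Cc (fun x => f x + g x).
Proof.
move=> [cf f0 kf] [cg g0 kg]; split.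
- by move=> x; apply: cvgD; [exact: cf|exact: cg].
- by move=> x; exact: addr_ge0.
- apply: (subclosed_compact _ (compactU kf kg)); first exact: closed_closure.
  rewrite -closureU; apply: closure_subset => x /=;
  have [->|] := eqVneq (f x) 0.
    by rewrite add0r; right.
  by left.
Qed.

(** The strict bound at [x] persists on a neighbourhood of [x], which is what a covering argument
    over a compact set requires. *)
Lemma nonneg_Cc_point (x : T) : locally_compact_hausdorff T ->
  exists2 f, nonneg_Cc f & 1 < f x.
Proof.
move=> [lT hT]; have [V [xV cV clV]] := locally_compact_nbhs x lT.
have clVo : closed (~` V°) by apply: open_closedC; exact: open_interior.
have nVx : ~ (~` V°) x by apply; exact: xV.
have /(uniform_separatorP (R := R)) [f [cf f01 f0 f1]] :=
  locally_compact_completely_regular (R := R) lT hT clVo nVx.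
(* The separator [f] is 0 at [x] and 1 off the interior of [V], so [2 - f - f] is 2 at [x],
   nonnegative, and zero off the compact set [V]. *)
have cg : continuous (fun x => 2 - f x - f x).
  by move=> y; apply: cvgB; [apply: cvgB; [exact: cvg_cst|exact: cf]|exact: cf].
exists (fun x => 2 - f x - f x).
  split => // [y|].
    have /f01 /= : range f (f y) by exists y.
    by rewrite in_itv /= => /andP[_ fy];
      rewrite -addrA -opprD subr_ge0 -[leRHS]/(1 + 1) lerD.
  apply: (subclosed_compact _ cV); first exact: closed_closure.
  rewrite [X in _ `<=` X](iffLR (closure_id _) clV);
  apply: closure_subset => y /= fy.
  apply: contrapT => nVy; move: fy; rewrite (f1 (f y)) ?subrr//.
    by rewrite -addrA -opprD subrr eqxx.
  by exists y => //; apply: contra_not nVy => /interior_subset.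
by rewrite (f0 (f x)) ?subr0 ?ltr1n//; exists x.
Qed.

Lemma cutoff (K : set T) : locally_compact_hausdorff T -> compact K ->
  exists2 f, nonneg_Cc f & forall x, K x -> 1 <= f x.
Proof.
move=> lT /compact_near_coveringP cK.
(* The covering is taken along the filter of upper sections of nonneg_Cc, which
   is directed because nonneg_Cc is closed under sums. *)
pose up (f : T -> R) := [set g | nonneg_Cc g /\ forall x, f x <= g x].
have FF : Filter (filter_from nonneg_Cc up).
  apply: filter_from_filter; first by exists (fun=> 0); exact: nonneg_Cc0.
  move=> f g kf kg; exists (fun x => f x + g x); first exact: nonneg_CcD.
  move=> h [kh fgh]; split; split=> // x; apply: le_trans (fgh x).
    by rewrite lerDl; case: kg.
  by rewrite lerDr; case: kf.
have PF : ProperFilter (filter_from nonneg_Cc up).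
  by apply: filter_from_proper => // f kf; exists f.
have /filter_ex [f [kf Kf]] : \forall f \near filter_from nonneg_Cc up,
    nonneg_Cc f /\ K `<=` [set x | 1 <= f x].
  apply: filterI.
    by exists (fun=> 0); [exact: nonneg_Cc0|move=> f []].
  apply: (cK _ _ (fun (f : T -> R) x => 1 <= f x) FF) => x Kx.
  have [f kf fx1] := nonneg_Cc_point x lT.
  have [cf _ _] := kf.
  (* On the neighbourhood where [1 < f], every [g] above [f] is at least 1. *)
  exists ([set y | 1 < f y], up f) => /=; last first.
    by move=> [y g] [/= /ltW fy [_ fg]]; exact: le_trans (fg y).
  split; last by exists f.
  exact: (cf x _ (lt_nbhsr fx1)).
by exists f.
Qed.

End cutoff.

(** * Integrability and uniform estimates for compactly supported functions *)

Lemma continuous_borel_measurable (R : realType) (T : topologicalType) (x0 : T)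
    (f : T -> R) :
  continuous f -> measurable_fun [set: borelType x0] f.
Proof.
move=> /continuousP cf.
apply: (measurability _ (RGenOpens.measurableE R)).
move=> _ [_ [a [b ->]] <-]; rewrite setTI; apply: sub_sigma_algebra.
exact/cf/interval_open.
Qed.

(** The closed support [K] is Borel of finite measure, [f] is bounded on it by compactness, and [f]
    equals its restriction to [K]. *)
Lemma Cc_integrable (R : realType) (T : topologicalType) (x0 : T)
    (m : {measure set (borelType x0) -> \bar R}) (f : T -> R) :
  (forall K : set T, compact K -> (m K < +oo)%E) ->
  continuous f -> compact (closure [set x | f x != 0]) ->
  m.-integrable setT (EFin \o f).
Proof.
move=> mfin cf; set K := closure _ => cK.
have mf := continuous_borel_measurable (x0 := x0) cf.
have mK : measurable (K : set (borelType x0)).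
  rewrite -(setCK K); apply: measurableC; apply: sub_sigma_algebra.
  by apply: closed_openC; exact: closed_closure.
have -> : EFin \o f = (EFin \o f) \_ K.
  apply/funext => x; rewrite patchE.
  case: ifPn => //; rewrite notin_setE => nKx.
  suff -> : (EFin \o f) x = 0%E by [].
  congr EFin; apply: contrapT => /eqP fx; apply: nKx.
  exact: subset_closure.
apply/(integrable_mkcond (mu := m) (EFin \o f) mK).
apply: (measurable_bounded_integrable (mu := m) mK (mfin K cK)).
  exact: measurable_funTS.
have /compact_bounded[M [_ Mf]] : compact (f @` K).
  by apply: continuous_compact => //; exact: continuous_subspaceT.
exists M; split; rewrite ?num_real// => r Mr x Kx.
by apply: (Mf r Mr); exists x.
Qed.

(** The section vanishes off the projection of the support of [h]; this projection is compact, hence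
    closed because [E] is Hausdorff. *)
Lemma section_support_compact (R : realType) (E G : topologicalType) (g : G)
    (h : E * G -> R) : hausdorff_space E ->
  compact (closure [set z | h z != 0]) ->
  compact (closure [set e | h (e, g) != 0]).
Proof.
move=> hE ch.
have cK : compact (fst @` closure [set z | h z != 0]).
  apply: continuous_compact => //.
  by apply: continuous_subspaceT => z; exact: cvg_fst.
apply: (subclosed_compact _ cK); first exact: closed_closure.
rewrite [X in _ `<=` X](iffLR (closure_id _) (compact_closed hE cK)).
apply: closure_subset => e /= heg.
by exists (e, g) => //; exact: subset_closure.
Qed.

(** Continuity at each [(e, g0)] gives a bound on a product neighbourhood; compactness of [K] yields
    one neighbourhood of [g0] valid for all [e] in [K]. *)
Lemma continuous_uniform_section (R : realType) (E G : topologicalType)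
    (K : set E) (h : E * G -> R) (g0 : G) (d : R) :
  compact K -> continuous h -> 0 < d ->
  \forall g \near g0, forall e, K e -> `|h (e, g0) - h (e, g)| < d.
Proof.
move=> /compact_near_coveringP cK ch d0.
apply: (cK _ _ (fun g e => `|h (e, g0) - h (e, g)| < d)) => e Ke.
have d20 : 0 < d / 2 by rewrite divr_gt0.
have /cvgrPdist_lt /(_ _ d20) [[A B] [/= eA gB] AB] := ch (e, g0).
exists (A, B) => // -[e' g] [/= Ae' Bg].
(* Both [(e', g0)] and [(e', g)] lie in the neighbourhood where [h] is within [d / 2] of
   [h (e, g0)]. *)
rewrite (splitr d) -(subrK (h (e, g0)) (h (e', g0))) -addrA.
apply: le_lt_trans (ler_normD _ _) _; rewrite ltrD//.
  by rewrite distrC; apply: (AB (e', g0)); split=> //; exact: nbhs_singleton.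
exact: (AB (e', g)).
Qed.

(** * Joint continuity of the integrals of sections *)

Section continuous_section_integral.
Context {R : realType} {V E G : topologicalType} {e0 : E}.
Variable m : V -> {measure set (borelType e0) -> \bar R}.
Hypothesis lE : locally_compact_hausdorff E.
Hypothesis mfin : forall v (K : set E), compact K -> (m v K < +oo)%E.
Hypothesis mcont : forall f : E -> R, continuous f ->
  compact (closure [set e | f e != 0]) ->
  continuous (fun v => \int[m v]_e f e).

Lemma continuous_section_integral (h : E * G -> R) :
  continuous h -> compact (closure [set z | h z != 0]) ->
  continuous (fun z : V * G => \int[m z.1]_e h (e, z.2)).
Proof.
move=> ch kh [v0 g0].
set K := fst @` closure [set z | h z != 0].
have cK : compact K.
  apply: continuous_compact => //.
  by apply: continuous_subspaceT => z; exact: cvg_fst.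
(* [K] does not depend on [g], so a single cutoff controls every section of [h]. *)
have hK g e : ~ K e -> h (e, g) = 0.
  apply: contra_notP => /eqP heg; exists (e, g) => //; exact: subset_closure.
have [chi [cchi chi0 kchi] chi1] := cutoff (R := R) lE cK.
have chg g : continuous (fun e => h (e, g)).
  by move=> e; apply: continuous_comp; [exact: continuous_pairl|exact: ch].
have khg g := section_support_compact (g := g) lE.2 kh.
have ihg v g : (m v).-integrable setT (EFin \o (fun e => h (e, g))).
  by apply: Cc_integrable => //; exact: mfin.
have ichi v : (m v).-integrable setT (EFin \o chi).
  by apply: Cc_integrable => //; exact: mfin.
apply/cvgrPdist_lt => eps eps0 /=.
set M := \int[m v0]_e chi e.
have M0 : 0 <= M by apply: Rintegral_ge0 => e _; exact: chi0.
(* [M + 1] is positive and bounds the integral of [chi] against [m v] for [v] near [v0], so an error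
   of [d * chi] costs at most [eps / 2]. *)
pose d := eps / 2 / (M + 1).
have d0 : 0 < d by rewrite !divr_gt0// ltr_wpDl.
near=> z.
(* The intermediate value changes the measure first, at fixed [g0], and then the section, at fixed
   measure [m z.1]. *)
rewrite (splitr eps) -(subrK (\int[m z.1]_e h (e, g0)) (\int[m v0]_e _)) -addrA.
apply: le_lt_trans (ler_normD _ _) _; rewrite ltr_leD//.
  near: z.
  have eps20 : 0 < eps / 2 by rewrite divr_gt0.
  have /cvgrPdist_lt/(_ _ eps20) := mcont (chg g0) (khg g0) (x := v0).
  exact: cvg_fst.
rewrite -RintegralB//.
have ihB : (m z.1).-integrable setT (EFin \o (fun e => h (e, g0) - h (e, z.2))).
  exact: (integrableB (mu := m z.1) measurableT (ihg _ _) (ihg _ _)).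
apply: le_trans (le_normr_Rintegral (mu := m z.1) _ _) _ => //.
have idchi : (m z.1).-integrable setT (EFin \o (fun e => d * chi e)).
  exact: (integrableZl (mu := m z.1) measurableT d (ichi _)).
apply: (@le_trans _ _ (\int[m z.1]_e (d * chi e))).
  apply: le_Rintegral => //.
    exact: (integrable_abse (mu := m z.1) ihB).
  (* On [K] the difference is below [d] and [chi] is at least 1; off [K] both values of [h] are
     zero. *)
  move=> e _; have [Ke|nKe] := pselect (K e); last first.
    by rewrite !hK// subrr normr0 mulr_ge0// ltW.
  apply: (@le_trans _ _ d); last by rewrite ler_pMr// chi1.
  apply: ltW; move: e Ke; near: z.
  have := continuous_uniform_section g0 cK ch d0; exact: cvg_snd.
rewrite RintegralZl//.
have -> : eps / 2 = d * (M + 1) by rewrite /d divfK// gt_eqF// ltr_wpDl.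
rewrite ler_pM2l//; apply: ltW; near: z.
have : \forall v \near v0, \int[m v]_e chi e < M + 1.
  have /cvgr_lt := mcont cchi kchi (x := v0); apply; by rewrite ltrDl.
exact: cvg_fst.
Unshelve. all: by end_near. Qed.

End continuous_section_integral.

(** * Complex functions through their real and imaginary parts *)

Lemma normc_ge_Im (R : realType) (z : R[i]) : (`|complex.Im z|%:C)%C <= `|z|.
Proof.
by case: z => a b; rewrite normc_def /= lecR -sqrtr_sqr ler_wsqrtr// lerDr
  sqr_ge0.
Qed.

Lemma normc_le_ReIm (R : realType) (z : R[i]) :
  `|z| <= ((`|complex.Re z| + `|complex.Im z|)%:C)%C.
Proof.
case: z => a b; rewrite normc_def /= lecR
  -(ger0_norm (addr_ge0 (normr_ge0 a) (normr_ge0 b))).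
rewrite -sqrtr_sqr ler_wsqrtr// sqrrD !real_normK ?num_real//.
by rewrite lerD2r lerDl mulrn_wge0// mulr_ge0.
Qed.

Lemma continuous_complexP (R : realType) (T : topologicalType)
    (f : T -> R[i]^o) :
  continuous f <->
  continuous (fun x => complex.Re (f x)) /\
  continuous (fun x => complex.Im (f x)).
Proof.
split=> [cf|[cr ci] x].
  by split=> x; apply/cvgrPdist_lt => e e0;
     have eC0 : 0 < (e%:C)%C by [rewrite ltcR];
     move: (cf x) => /cvgrPdist_lt/(_ _ eC0); apply: filterS => y fxy;
     rewrite -ltcR; apply: le_lt_trans fxy; rewrite -raddfB;
     [exact: normc_ge_Re|exact: normc_ge_Im].
(* A positive element of [R[i]] has zero imaginary part, so [e] may be replaced by its real part. *)
apply/cvgrPdist_lt => e; rewrite ltcE => /andP[/eqP ie re].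
have -> : e = ((complex.Re e)%:C)%C by move: ie; case: e {re} => a b /= ->.
have e20 : 0 < complex.Re e / 2 by rewrite divr_gt0.
have /cvgrPdist_lt/(_ _ e20) Hr := cr x.
have /cvgrPdist_lt/(_ _ e20) Hi := ci x.
near=> y.
apply: le_lt_trans (normc_le_ReIm _) _.
rewrite ltcR (splitr (complex.Re e)) !raddfB.
by rewrite ltrD//; near: y.
Unshelve. all: by end_near. Qed.

(** The set function on the left is the pushforward of [m] under [e |-> (e, g)], so this is the
    change of variables formula. *)
Lemma integral_section (R : realType) (E G : topologicalType) (e0 : E)
    (z0 : E * G) (m : {measure set (borelType e0) -> \bar R}) (g : G)
    (h : E * G -> R) :
  continuous h -> m.-integrable setT (EFin \o (fun e => h (e, g))) ->
  (\int[(fun A => m [set e | A (e, g)]) : set (borelType z0) -> \bar R]_z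
     (h z)%:E = \int[m]_e (h (e, g))%:E)%E.
Proof.
move=> ch ih.
have mp : measurable_fun [set: borelType e0]
    ((fun e => (e, g)) : borelType e0 -> borelType z0).
  move=> _ A mA; rewrite setTI.
  exact: borel_sets_preimage (@continuous_pairl _ _ g) mA.
have /measurable_EFinP mh := continuous_borel_measurable (x0 := z0) ch.
exact: (integral_pushforward mp mh ih measurableT).
Qed.

Section Cc_parts.
Context {R : realType} {T : topologicalType}.

Lemma Cc_Re (f : T -> R[i]^o) : Cc f ->
  continuous (fun x => complex.Re (f x)) /\
  compact (closure [set x | complex.Re (f x) != 0]).
Proof.
move=> [/continuous_complexP[cr _] kf]; split=> //.
apply: (subclosed_compact _ kf); first exact: closed_closure.
by apply: closure_subset => x /=; apply: contra_neq => ->.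
Qed.

Lemma Cc_Im (f : T -> R[i]^o) : Cc f ->
  continuous (fun x => complex.Im (f x)) /\
  compact (closure [set x | complex.Im (f x) != 0]).
Proof.
move=> [/continuous_complexP[_ ci] kf]; split=> //.
apply: (subclosed_compact _ kf); first exact: closed_closure.
by apply: closure_subset => x /=; apply: contra_neq => ->.
Qed.

(** Allows real functions to be used in the continuity condition of a quiver, which is stated for
    complex ones. *)
Lemma Cc_real (f : T -> R) : continuous f ->
  compact (closure [set x | f x != 0]) ->
  Cc (fun x => (f x)%:C%C : R[i]^o).
Proof.
move=> cf kf; split.
  by apply/continuous_complexP; split=> //= x; exact: cvg_cst.
apply: (subclosed_compact _ kf); first exact: closed_closure.
by apply: closure_subset => x /=; apply: contra_neq => ->.
Qed.

End Cc_parts.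

(** * The quiver axioms for the skew product *)

Theorem proposition3p2 (R : realType) (Q : quiver R)
    (G : topologicalGroupType) (kappa : edge Q -> G) :
  topological_quiver Q -> locally_compact_hausdorff G -> continuous kappa ->
  topological_quiver (skew_product kappa).
Proof.
case=> lV lE cr cs os rad supp cont prop lG ck; split => /=.
- exact: locally_compact_hausdorff_prod.
- exact: locally_compact_hausdorff_prod.
- apply: continuous_pair; first exact: continuous_comp_fst.
  move=> z; apply: (@continuous_comp _ _ _
    (fun z : edge Q * G => (kappa z.1, z.2)) (fun z => (z.1 * z.2)%g));
    last exact: mulg_continuous.
  apply: continuous_pair; first exact: continuous_comp_fst.
  by move=> ?; exact: cvg_snd.
- apply: continuous_pair; first exact: continuous_comp_fst.
  by move=> ?; exact: cvg_snd.
- exact: open_map_prodr.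
- by move=> [v g]; apply: section_radon_measure; [exact: lG.2|exact: rad].
- move=> [v g] /=; have [[mu0 _ _] _ _ _] := rad v.
  rewrite (section_support g lG.2 mu0) supp.
  by apply/seteqP; split=> [[e h] /= [-> ->]|[e h] /= [-> ->]].
- move=> z0 f cf.
  (* The edge [z0.1] serves as base point of [edge Q], and all the [edge_measure v] are bundled as
     measures at once. *)
  have /choice[m mE] v : exists m : {measure set (borelType z0.1) -> \bar R},
      m = edge_measure v :> (set (edge Q) -> \bar R).
    by apply/borel_measureP; case: (rad v).
  have mfin v (K : set (edge Q)) : compact K -> (m v K < +oo)%E.
    by rewrite mE; case: (rad v) => _ + _ _; exact.
  have mcont (h : edge Q -> R) :
      continuous h -> compact (closure [set e | h e != 0]) ->
      continuous (fun v => \int[m v]_e h e).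
    (* The real part of the complex integral of a real function is its real integral. *)
    move=> ch kh; have /continuous_complexP[+ _] := cont z0.1 _ (Cc_real ch kh).
    rewrite (_ : (fun v => complex.Re _) = fun v => \int[m v]_e h e)//.
    by apply/funext => v; rewrite /Rintegral mE.
  have int h (vg : vertex Q * G) :
      continuous h -> compact (closure [set z | h z != 0]) ->
      fine (\int[(fun A => edge_measure vg.1 [set e | A (e, vg.2)])
        : set (borelType z0) -> \bar R]_z (h z)%:E)%E =
      \int[m vg.1]_e h (e, vg.2).
    move=> ch kh; rewrite -mE integral_section//.
    apply: Cc_integrable; first exact: mfin.
      by move=> e; apply: continuous_comp; [exact: continuous_pairl|exact: ch].
    exact: section_support_compact lE.2 kh.
  have [[cre kre] [cim kim]] := (Cc_Re cf, Cc_Im cf).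
  apply/continuous_complexP; split; rewrite /complex_integral /=.
    rewrite (funext (fun vg => int (fun z => complex.Re (f z)) vg cre kre)).
    exact: (continuous_section_integral (m := m) lE mfin mcont cre kre).
  rewrite (funext (fun vg => int (fun z => complex.Im (f z)) vg cim kim)).
  exact: (continuous_section_integral (m := m) lE mfin mcont cim kim).
- move=> [v g]; have [A mA vA] := prop v.
  (* The section of this cylinder at [g] is [A] itself, whose measure is nonzero. *)
  exists (fst @^-1` A) => //.
  by apply: borel_sets_preimage mA => z; exact: cvg_fst.
Qed.
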